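(* In the setting described in the context, the sequence $(u_m)_{m\ge0}$ is almost surely not eventually constant. Moreover, for every realization in which $(u_m)_{m\ge0}$ is not eventually constant, the sequence $(z_m)_{m\ge0}$ converges in $\overline{\mathbb{H}}$ to some point $\zeta\in\overline{\mathbb{R}}$.
   Context: Let $\mathbb{H}=\{z\in\mathbb{C}:\operatorname{Im}z>0\}$ be the Poincaré upper half-plane (metric $(dx^2+dy^2)/y^2$), $\overline{\mathbb{R}}=\mathbb{R}\cup\{\infty\}$, and $\overline{\mathbb{H}}=\mathbb{H}\cup\overline{\mathbb{R}}$ (a closed disk). A (hyperbolic) line is a set $\{z\in\mathbb{H}:\operatorname{Re}z=x\}$ or $\{z\in\mathbb{H}:|z-x|=r\}$ with $x\in\mathbb{R}$, $r>0$; its reflection $t_L$ is $t_L(z)=2x-\bar z$, resp. $t_L(z)=r^2/(\bar z-x)+x$, extended continuously to $\overline{\mathbb{H}}$. Fix lines $L_1,L_2,L_3\subseteq\mathbb{H}$ and $z_0\in\mathbb{H}$ such that for all distinct $i,i'\in\{1,2,3\}$ either (a) $L_i\cap L_{i'}=\emptyset$ and $z_0$ lies in the connected component of $\mathbb{H}\setminus(L_i\cup L_{i'})$ whose boundary contains both lines, or (b) $L_i,L_{i'}$ meet at an angle of measure $\pi/m(i,i')$ with $m(i,i')\ge2$ an integer, and $z_0$ lies in the interior of that angle. Let $s_i=t_{L_i}$, let $W$ be the group generated by $S=\{s_1,s_2,s_3\}$ (a Coxeter system; $W$ is infinite and acts properly on $\mathbb{H}$), and let $\ell$ be the word length with respect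 to $S$. Let $i_1,i_2,\ldots$ be independent uniform random elements of $\{1,2,3\}$. Define $u_0=1$ and $u_{m+1}=u_m s_{i_{m+1}}$ if $\ell(u_ms_{i_{m+1}})>\ell(u_m)$, and $u_{m+1}=u_m$ otherwise (this is $u_m=s_{i_1}\star\cdots\star s_{i_m}$ for the Demazure product $\star$), and set $z_m=u_m(z_0)$. *)

(* Defs.v *)
From HB Require Import structures.
From mathcomp Require Import all_boot all_order all_algebra.
From mathcomp Require Import all_classical all_reals all_analysis.
Set Implicit Arguments. Unset Strict Implicit. Unset Printing Implicit Defensive.
Import Order.TTheory GRing.Theory Num.Theory.
Import numFieldNormedType.Exports.
Local Open Scope classical_set_scope.
Local Open Scope ring_scope.

Section Hyp.
Variable R : realType.

(* Points of the upper half-plane are pairs (x, y) = x + i y with y > 0. *)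
Definition pt := (R * R)%type.
Definition inH (z : pt) : Prop := 0 < z.2.

(* Hyperbolic lines: Vert x = {Re z = x}, Circ x r = {|z - x| = r}. *)
Inductive hline := Vert of R | Circ of R & R.

Definition line_ok (L : hline) : Prop :=
  match L with Vert _ => True | Circ _ r => 0 < r end.

(* Defining function of the line: L = {z in H | lfun L z = 0};
   its two sides are {lfun L > 0} and {lfun L < 0}. *)
Definition lfun (L : hline) (z : pt) : R :=
  match L with
  | Vert a => z.1 - a
  | Circ a r => (z.1 - a) ^+ 2 + z.2 ^+ 2 - r ^+ 2
  end.

Definition lgrad (L : hline) (z : pt) : pt :=
  match L with
  | Vert _ => (1, 0)
  | Circ a _ => (2 * (z.1 - a), 2 * z.2)
  end.

Definition on_line (L : hline) (z : pt) : Prop := inH z /\ lfun L z = 0.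

(* The reflection t_L: t(z) = 2x - conj z, resp. r^2/(conj z - x) + x. *)
Definition refl (L : hline) (z : pt) : pt :=
  match L with
  | Vert a => (2 * a - z.1, z.2)
  | Circ a r =>
      let d := (z.1 - a) ^+ 2 + z.2 ^+ 2 in
      (a + r ^+ 2 * (z.1 - a) / d, r ^+ 2 * z.2 / d)
  end.

Definition dotp (u v : pt) : R := u.1 * v.1 + u.2 * v.2.
Definition enorm (u : pt) : R := Num.sqrt (dotp u u).

(* Condition (a): the lines are disjoint and z0 lies in the component of
   H \ (L u L') whose boundary contains both lines, i.e. on the side of L
   containing L' and on the side of L' containing L. *)
Definition cond_disjoint (L L' : hline) (z0 : pt) : Prop :=
  ~ (exists p, on_line L p /\ on_line L' p) /\
  (forall p, on_line L' p -> 0 < lfun L z0 * lfun L p) /\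
  (forall p, on_line L p -> 0 < lfun L' z0 * lfun L' p).

(* Condition (b): L and L' meet (at p) at an angle of measure pi/m, m >= 2,
   and z0 lies in the interior of that angle: z0 lies off both lines, and the
   open sector {sign lfun L = eps} /\ {sign lfun L' = eps'} containing z0 has
   (Euclidean = hyperbolic, by conformality) opening angle pi/m at p.  The
   opening angle theta of the sector bounded by half-planes with inward normals
   n, n' satisfies cos theta = - <n, n'> / (|n| |n'|), with n = eps * lgrad. *)
Definition cond_angle (L L' : hline) (z0 : pt) : Prop :=
  exists (m : nat) (p : pt), (2 <= m)%N /\ on_line L p /\ on_line L' p /\
    lfun L z0 != 0 /\ lfun L' z0 != 0 /\
    Num.sg (lfun L z0 * lfun L' z0) * dotp (lgrad L p) (lgrad L' p)
      = - (enorm (lgrad L p) * enorm (lgrad L' p)) * cos (pi / m%:R).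

(* Words in the generators s_0, s_1, s_2 (indices shifted to 'I_3).
   The word [:: j1; ...; jk] represents s_j1 * ... * s_jk, acting on H by
   z |-> s_j1 (s_j2 (... (s_jk z))). *)
Definition act (L : 'I_3 -> hline) (w : seq 'I_3) (z : pt) : pt :=
  foldr (fun j acc => refl (L j) acc) z w.

(* Two words represent the same element of W (W acts faithfully on H). *)
Definition word_eq (L : 'I_3 -> hline) (w w' : seq 'I_3) : Prop :=
  forall z, inH z -> act L w z = act L w' z.

Lemma word_len_ex (L : 'I_3 -> hline) (w : seq 'I_3) :
  exists n, `[< exists w', word_eq L w w' /\ size w' = n >].
Proof. by exists (size w); apply/asboolP; exists w. Qed.

Definition ell (L : 'I_3 -> hline) (w : seq 'I_3) : nat := ex_minn (word_len_ex L w).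

(* u_0 = 1, u_{m+1} = u_m s_{i_{m+1}} if ell increases, else u_m.
   Here idx m plays the role of i_{m+1}. *)
Fixpoint demazure (L : 'I_3 -> hline) (idx : nat -> 'I_3) (m : nat) : seq 'I_3 :=
  match m with
  | 0 => [::]
  | m'.+1 =>
      let u := demazure L idx m' in
      if (ell L u < ell L (rcons u (idx m')))%N then rcons u (idx m') else u
  end.

Definition eventually_const (L : 'I_3 -> hline) (u : nat -> seq 'I_3) : Prop :=
  exists N, forall m, (N <= m)%N -> word_eq L (u m) (u N).

(* Convergence in the closed disk H u R u {oo} to a boundary point:
   Some a = the real point a, None = oo. *)
Definition conv_bdry (z : nat -> pt) (zeta : option R) : Prop :=
  match zeta with
  | Some a => ((fun m => (z m).1) @ \oo --> a) /\ ((fun m => (z m).2) @ \oo --> 0)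
  | None => forall M : R, \forall m \near \oo, M < (z m).1 ^+ 2 + (z m).2 ^+ 2
  end.

End Hyp.

(* Main.v *)
Require Import Defs.
From HB Require Import structures.
From mathcomp Require Import all_boot all_order all_algebra.
From mathcomp Require Import all_classical all_reals all_analysis.
From mathcomp Require Import ring lra zify.
Import Order.TTheory GRing.Theory Num.Theory.
Import numFieldNormedType.Exports.
Local Open Scope classical_set_scope.
Local Open Scope ring_scope.

Set Implicit Arguments. Unset Strict Implicit. Unset Printing Implicit Defensive.

(* In the hyperboloid model let [e i] be the unit normal of [L i] pointing to
   the side of [z0]; then [<e i, e j>] is [-cos (pi / m)] or at most [-1].

   As in Tits' theorem on the geometric representation, [l(w s_i) >= l(w)]
   implies [<e i, w^-1 z0> > 0]: factor [w = v a] with [a] an alternating word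
   in two letters and [v] having both letters as ascents, and compute in the
   dihedral group. If the process stopped at [u] although all letters recur,
   [u^-1 z0] would lie on the negative side of all three lines, which is
   impossible because the Gram matrix of the normals is not positive definite.

   Let [z_m = u_m z0]. Each step of a reduced word reflects towards all later
   points, so [d(z_m, z_n) <= d(z0, z_n)] for [m <= n]; moreover distinct points
   of the sequence are uniformly separated, so [z_m] leaves every compact set.
   In the Klein disk the first fact bounds [|z_m - z_n|^2] by a constant over
   the time coordinate of [z_m], hence the sequence is Cauchy, and its limit is
   on the boundary. *)

(** * The hyperboloid model: points, lines and reflections *)

Section Hyperboloid.
Variable R : realType.
Implicit Types (z : pt R) (L : hline R).

(* In the coordinates [(A, B, C)] the quadratic form is [B^2 - A C]; the
   half-plane is the sheet [A > 0] of [B^2 - A C = -1]. *)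
Definition vec := (R * R * R)%type.
Implicit Types (u v w : vec).

Definition lform v w : R :=
  v.1.2 * w.1.2 - (v.1.1 * w.2 + v.2 * w.1.1) / 2.

(** These are the coefficients of the quadratic [A t^2 - 2 B t + C] with root [z], scaled so that
    [A C - B^2 = 1]. *)
Definition emb z : vec := (z.2^-1, z.1 / z.2, (z.1 ^+ 2 + z.2 ^+ 2) / z.2).

(** Normalised to length one, with the sign for which the product with [emb z] has the sign of
    [lfun L z]. *)
Definition lnormal L : vec :=
  match L with
  | Vert a => (0, 1, 2 * a)
  | Circ a r => (- r^-1, - (a / r), - ((a ^+ 2 - r ^+ 2) / r))
  end.

(** It serves twice: as the factor between [lfun] and the form in [lfunE], and as the Euclidean
    length of [lgrad L] on the line. *)
Definition lscale L : R := match L with Vert _ => 1 | Circ _ r => 2 * r end.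

Definition scalev (c : R) v : vec := (c * v.1.1, c * v.1.2, c * v.2).

(* [hdist z z'] is the hyperbolic cosine of the distance. *)
Definition hdist z z' : R := - lform (emb z) (emb z').

Lemma lformC v w : lform v w = lform w v.
Proof. rewrite /lform; ring. Qed.

Lemma lformZl c v w : lform (scalev c v) w = c * lform v w.
Proof. rewrite /lform /=; ring. Qed.

Lemma lformZr c v w : lform v (scalev c w) = c * lform v w.
Proof. by rewrite lformC lformZl lformC. Qed.

Lemma inH_neq0 z : inH z -> z.2 != 0.
Proof. by rewrite /inH => /lt0r_neq0. Qed.

Lemma hdistE z z' : inH z -> inH z' ->
  hdist z z' = 1 + ((z.1 - z'.1) ^+ 2 + (z.2 - z'.2) ^+ 2) / (2 * z.2 * z'.2).
Proof.
move=> /inH_neq0 hz /inH_neq0 hz'; rewrite /hdist /lform /emb /=.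
by field; rewrite hz hz'.
Qed.

Lemma hdistC z z' : hdist z z' = hdist z' z.
Proof. by rewrite /hdist lformC. Qed.

Lemma hdist_ge1 z z' : inH z -> inH z' -> 1 <= hdist z z'.
Proof.
move=> hz hz'; rewrite hdistE // lerDl divr_ge0 //.
  by rewrite addr_ge0 ?sqr_ge0.
by rewrite !mulr_ge0 // ltW.
Qed.

Lemma emb_norm z : inH z -> lform (emb z) (emb z) = -1.
Proof.
by move=> /inH_neq0 hz; rewrite /lform /emb /=; field.
Qed.

(** The form is nondegenerate. Equality is tested through products, so that linear formulas such as
    [emb_refl] apply without a vector space structure on triples. *)
Lemma emb_inj z z' : inH z -> inH z' ->
  (forall v, lform v (emb z) = lform v (emb z')) -> z = z'.
Proof.
case: z z' => [x y] [x' y'] /inH_neq0 /= hz /inH_neq0 /= hz' h.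
have := h (0, 0, 1); have := h (0, 1, 0); rewrite /lform /emb /= => h1 h2.
have e : y^-1 = y'^-1 by lra.
have ey : y = y' by apply: invr_inj.
have : x / y = x' / y' by lra.
by rewrite ey => /(mulIf (invr_neq0 hz')) ->.
Qed.

Lemma lnormal_norm L : line_ok L -> lform (lnormal L) (lnormal L) = 1.
Proof.
case: L => [a|a r] /=; rewrite /lform /=; first by move=> _; lra.
by move=> /lt0r_neq0 r0; field.
Qed.

Lemma lscale_gt0 L : line_ok L -> 0 < lscale L.
Proof. by case: L => [a|a r] //= r0; rewrite mulr_gt0. Qed.

Lemma lfunE L z : line_ok L -> inH z ->
  lfun L z = lscale L * z.2 * lform (lnormal L) (emb z).
Proof.
case: L => [a|a r] /=; rewrite /lform /emb /=.
  by move=> _ /inH_neq0 hz; field.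
by move=> /lt0r_neq0 r0 /inH_neq0 hz; field; rewrite hz r0.
Qed.

Lemma sqnorm_gt0 (x y : R) : 0 < y -> 0 < x ^+ 2 + y ^+ 2.
Proof. by move=> y0; rewrite ltr_wpDl ?sqr_ge0 ?exprn_gt0. Qed.

Lemma inH_refl L z : line_ok L -> inH z -> inH (refl L z).
Proof.
rewrite /inH; case: L => [a|a r] //= r0 hz.
by rewrite divr_gt0 ?sqnorm_gt0 // mulr_gt0 ?exprn_gt0.
Qed.

(** On the hyperboloid the inversion becomes the linear reflection [X - 2 <n, X> n] in the unit
    normal [n]. *)
Lemma emb_refl L z v : line_ok L -> inH z ->
  lform v (emb (refl L z))
  = lform v (emb z) - 2 * lform (lnormal L) (emb z) * lform v (lnormal L).
Proof.
case: L => [a|a r] /=; rewrite /lform /emb /=.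
  by move=> _ /inH_neq0 hz; field.
move=> /lt0r_neq0 r0 hz; have := sqnorm_gt0 (z.1 - a) hz => /lt0r_neq0 hd.
by field; rewrite (inH_neq0 hz) r0 hd.
Qed.

(** Conformality of the model: the Euclidean angle between the gradients at a common point is read
    off from the normals. *)
Lemma dotp_lgrad L L' p : line_ok L -> line_ok L' ->
  on_line L p -> on_line L' p ->
  dotp (lgrad L p) (lgrad L' p)
  = enorm (lgrad L p) * enorm (lgrad L' p) * lform (lnormal L) (lnormal L').
Proof.
have eN L0 : line_ok L0 -> on_line L0 p -> enorm (lgrad L0 p) = lscale L0.
  move=> h [hp h0]; rewrite /enorm.
  suff -> : dotp (lgrad L0 p) (lgrad L0 p) = lscale L0 ^+ 2.
    by rewrite sqrtr_sqr gtr0_norm ?lscale_gt0.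
  by move: h h0; case: L0 => [a|a r] /= h h0; rewrite /dotp /=; lra.
move=> ok ok' hp hp'; rewrite !eN //.

case: hp hp' => _ + [_].
case: L ok => [a|a r]; case: L' ok' => [a'|a' r'] /= ok ok' e e';
  rewrite /dotp /lform /=.
- by lra.
- have -> : p.1 = a by lra.
  by move/lt0r_neq0: ok => r0; field.
- have -> : p.1 = a' by lra.
  by move/lt0r_neq0: ok' => r0; field.
- have -> : 2 * r * (2 * r') *
    (- (a / r) * - (a' / r') -
     (- r^-1 * - ((a' ^+ 2 - r' ^+ 2) / r') +
      - ((a ^+ 2 - r ^+ 2) / r) * - r'^-1) / 2)
    = 4 * a * a' - 2 * (a' ^+ 2 - r' ^+ 2 + a ^+ 2 - r ^+ 2).
    by field; rewrite (lt0r_neq0 ok) (lt0r_neq0 ok').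
  by lra.
Qed.

(** The product with [emb z0] selects the sheet; rescaling by the square root of [A C - B^2] then
    lands on the hyperboloid. *)
Lemma timelike_emb v z0 : lform v v < 0 -> inH z0 -> lform v (emb z0) < 0 ->
  exists (z : pt R) (c : R),
    [/\ inH z, 0 < c & forall w, lform w v = c * lform w (emb z)].
Proof.
case: v z0 => [[A B] C] [x y]; rewrite /inH {1}/lform /= => hQ y0 hv.
have hA : 0 < A.
  rewrite ltNge; apply/negP => A0; move: hv; rewrite ltNge => /negP; apply.
  have -> : lform (A, B, C) (emb (x, y))
      = - (A * (x ^+ 2 + y ^+ 2) - 2 * B * x + C) / (2 * y).
    by rewrite /lform /emb /=; field; rewrite gt_eqF.
  have A1 : A < 0.
    rewrite lt_neqAle A0 andbT; apply/eqP => A1; move: hQ; rewrite A1.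
    by have := sqr_ge0 B; lra.
  rewrite divr_ge0 ?mulr_ge0 ?(ltW y0) // oppr_ge0 -(nmulr_rge0 _ A1).
  by have := sqr_ge0 (A * x - B); have := sqr_ge0 (A * y); nra.
have hs : 0 < A * C - B ^+ 2 by lra.
set s := Num.sqrt (A * C - B ^+ 2).
have s0 : 0 < s by rewrite sqrtr_gt0.
have s2 : s ^+ 2 = A * C - B ^+ 2 by rewrite sqr_sqrtr // ltW.
(* The point is the root of [A t^2 - 2 B t + C] in the upper half-plane. *)
exists (B / A, s / A), s; split => //=; first by rewrite /inH divr_gt0.
move=> w; rewrite /lform /emb /=.
have -> : ((B / A) ^+ 2 + (s / A) ^+ 2) / (s / A) = C / s.
  rewrite !expr_div_n s2; field.
  by rewrite (lt0r_neq0 hA) (lt0r_neq0 s0).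
by field; rewrite (lt0r_neq0 hA) (lt0r_neq0 s0).
Qed.

(** Up to a negative factor the product is [A |z|^2 - 2 B x + C], and [A] times this is
    [(A x - B)^2 + (A y)^2 + (A C - B^2) > 0] if [A] is nonzero. If [A = 0] then [B = 0], and the
    sign of [C] decides. *)
Lemma causal_sign v z z' : lform v v <= 0 -> inH z -> inH z' ->
  0 < lform v (emb z) -> 0 < lform v (emb z').
Proof.
case: v => [[A B] C]; rewrite /inH; case: z z' => [x y] [x' y'] /=.
have E a b : 0 < b -> lform (A, B, C) (emb (a, b))
    = - (A * (a ^+ 2 + b ^+ 2) - 2 * B * a + C) / (2 * b).
  by move=> /lt0r_neq0 b0; rewrite /lform /emb /=; field.
move=> hQ y0 y'0; rewrite !E // !pmulr_lgt0 ?invr_gt0 ?mulr_gt0 // !oppr_gt0.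
move: hQ; rewrite /lform /= => hQ.
have M a b : 0 < b -> A != 0 -> 0 < A * (A * (a ^+ 2 + b ^+ 2) - 2 * B * a + C).
  move=> b0 A0; have : 0 < (A * b) ^+ 2 by rewrite exprn_even_gt0 //= mulf_neq0 // gt_eqF.
  by have := sqr_ge0 (A * a - B); nra.
have [A0|A0|A0] := ltgtP A 0.
- by move=> _; rewrite -(nmulr_rgt0 _ A0) M ?lt_eqF.
- by rewrite -(pmulr_rlt0 _ A0) ltNge ltW // M ?gt_eqF.
- have B0 : B = 0 by apply/eqP; rewrite -sqrf_eq0; apply/eqP; nra.
  by rewrite A0 B0; lra.
Qed.

(* The Gram determinant of [v, emb z, emb z'] is minus a square. *)
Lemma hdist_sqr_ge v z z' : lform v v = 1 -> inH z -> inH z' ->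
  lform v (emb z) * lform v (emb z') <= 0 ->
  1 + lform v (emb z) ^+ 2 <= hdist z z' ^+ 2.
Proof.
move=> hv hz hz' hneg.
have G u w x : lform u u * (lform w w * lform x x - lform w x ^+ 2)
   - lform u w * (lform u w * lform x x - lform w x * lform u x)
   + lform u x * (lform u w * lform w x - lform w w * lform u x) <= 0.
  have -> : lform u u * (lform w w * lform x x - lform w x ^+ 2)
   - lform u w * (lform u w * lform x x - lform w x * lform u x)
   + lform u x * (lform u w * lform w x - lform w w * lform u x)
   = - ((u.1.1 * (w.1.2 * x.2 - w.2 * x.1.2)
       - u.1.2 * (w.1.1 * x.2 - w.2 * x.1.1)
       + u.2 * (w.1.1 * x.1.2 - w.1.2 * x.1.1)) / 2) ^+ 2.
    by rewrite /lform; field.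
  by rewrite oppr_le0 sqr_ge0.
(* With [a], [b] the two products and [D] the product of the points, this reads
   [1 + a^2 + b^2 + 2 a b D <= D^2], where [2 a b D >= 0]. *)
have := G v (emb z) (emb z'); rewrite hv !emb_norm // -/(hdist _ _).
have := hdist_ge1 hz hz'; rewrite /hdist.
move: (lform (emb z) (emb z')) (lform v (emb z)) (lform v (emb z')) hneg.
by move=> D a b; nra.
Qed.

(* Projecting [emb z0] to the first line, resp. to the intersection of both,
   gives a timelike vector, hence a point of the half-plane, as soon as the
   form of the normals exceeds [-1]. *)
Lemma disjoint_lform u v z0 : inH z0 -> lform u u = 1 -> lform v v = 1 ->
  0 < lform u (emb z0) -> 0 < lform v (emb z0) ->
  (forall p, inH p -> lform u (emb p) = 0 -> 0 < lform v (emb p)) ->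
  (forall p, inH p -> lform v (emb p) = 0 -> 0 < lform u (emb p)) ->
  lform u v <= -1.
Proof.
move=> hz hu hv hx hy huv hvu.
set X := emb z0; set a := lform u v; set x := lform u X; set y := lform v X.
pose Y (s t : R) : vec := (X.1.1 - s * u.1.1 - t * v.1.1,
  X.1.2 - s * u.1.2 - t * v.1.2, X.2 - s * u.2 - t * v.2).
have EY w s t : lform w (Y s t) = lform w X - s * lform w u - t * lform w v.
  by rewrite /lform /=; ring.
have QX : lform X X = -1 by apply: emb_norm.
(* If each normal is orthogonal to [Y] or has coefficient zero, the norm of [Y] equals its product
   with [X], namely [-1 - (s x + t y) < 0]. *)
have onY s t : lform u (Y s t) = 0 \/ s = 0 -> lform v (Y s t) = 0 \/ t = 0 ->
    0 <= s * x + t * y ->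
  exists (p : pt R) (c : R),
    [/\ inH p, 0 < c & forall w, lform w (Y s t) = c * lform w (emb p)].
  move=> h1 h2 h3.
  have QX' : lform (Y s t) X = -1 - (s * x + t * y).
    by rewrite lformC EY QX ![lform X _]lformC -/x -/y; ring.
  have QY : lform (Y s t) (Y s t) = lform (Y s t) X.
    rewrite EY [lform _ u]lformC [lform _ v]lformC.
    have -> : s * lform u (Y s t) = 0 by case: h1 => ->; rewrite ?mulr0 ?mul0r.
    have -> : t * lform v (Y s t) = 0 by case: h2 => ->; rewrite ?mulr0 ?mul0r.
    by rewrite !subr0.
  by apply: (timelike_emb (z0 := z0)); rewrite -/X ?QY ?QX' //; lra.
(* At the foot of the perpendicular from [z0] to the first line the second normal is positive. *)
have yx : 0 < y - a * x.
  have Z : lform u (Y x 0) = 0 by rewrite EY hu -/x; ring.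
  have [|||p [c [hp c0 hw]]] := onY x 0; [by left|by right|nra|].
  move: Z; rewrite hw => /eqP; rewrite mulf_eq0 gt_eqF //= => /eqP /(huv p hp).
  by rewrite -(pmulr_rgt0 _ c0) -hw EY -/y [lform v u]lformC -/a; lra.
have xy : 0 < x - a * y.
  have Z : lform v (Y 0 y) = 0 by rewrite EY hv -/y; ring.
  have [|||p [c [hp c0 hw]]] := onY 0 y; [by right|by left|nra|].
  move: Z; rewrite hw => /eqP; rewrite mulf_eq0 gt_eqF //= => /eqP /(hvu p hp).
  by rewrite -(pmulr_rgt0 _ c0) -hw EY -/a -/x; lra.
rewrite leNgt; apply/negP => a1.
have a2 : a < 1.
  rewrite ltNge; apply/negP => a2.
  have : x <= a * x by rewrite ler_peMl // ltW.
  have : y <= a * y by rewrite ler_peMl // ltW.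
  by lra.
have a3 : 0 < 1 - a ^+ 2 by nra.
(* The solution of the Gram system: [Y s t] is orthogonal to both normals, so it yields a common
   point of the lines. *)
pose s := (x - a * y) / (1 - a ^+ 2); pose t := (y - a * x) / (1 - a ^+ 2).
have Zu : lform u (Y s t) = 0.
  by rewrite EY hu -/a -/x /s /t; field; rewrite gt_eqF.
have Zv : lform v (Y s t) = 0.
  by rewrite EY hv -/y [lform v u]lformC -/a /s /t; field; rewrite gt_eqF.
have [|||p [c [hp c0 hw]]] := onY s t; [by left|by left| |].
  by rewrite addr_ge0 // mulr_ge0 ?ltW // divr_gt0.
move: Zu; rewrite hw => /eqP; rewrite mulf_eq0 gt_eqF //= => /eqP /(huv p hp).
by rewrite -(pmulr_rgt0 _ c0) -hw Zv ltxx.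
Qed.

Lemma cond_disjoint_lform L L' z0 :
  line_ok L -> line_ok L' -> inH z0 -> cond_disjoint L L' z0 ->
  [/\ lfun L z0 != 0, lfun L' z0 != 0 &
    Num.sg (lfun L z0) * Num.sg (lfun L' z0) * lform (lnormal L) (lnormal L')
      <= -1].
Proof.
move=> ok ok' hz [_ [h h']].
(* Lines are nonempty, so the positivity conditions already force [z0] off both lines. *)
have ex (K : hline R) : line_ok K -> exists p, on_line K p.
  case: K => [a|a r] /= r0.
    by exists (a, 1); split; rewrite /inH //= subrr.
  by exists (a, r); split; rewrite /inH //=; ring.
have nz : lfun L z0 != 0.
  by have [p /h] := ex L' ok'; apply: contraTneq => ->; rewrite mul0r ltxx.
have nz' : lfun L' z0 != 0.
  by have [p /h'] := ex L ok; apply: contraTneq => ->; rewrite mul0r ltxx.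
split => //; rewrite -mulrA -lformZr -lformZl.
have sgn (K : hline R) : lfun K z0 != 0 -> Num.sg (lfun K z0) ^+ 2 = 1.
  by move=> K0; rewrite sqr_sg K0.
have pos (K : hline R) : line_ok K -> lfun K z0 != 0 ->
    forall p, inH p -> 0 < lfun K z0 * lfun K p ->
    0 < lform (scalev (Num.sg (lfun K z0)) (lnormal K)) (emb p).
  move=> okK K0 p hp; rewrite lformZl [lfun K p]lfunE // {1}[lfun K z0]numEsg.
  have : 0 < `|lfun K z0| * (lscale K * p.2).
    by rewrite !mulr_gt0 ?normr_gt0 ?lscale_gt0.
  move: (Num.sg _) (`|_|) (lscale K * p.2) (lform _ _) => s n c l n0.
  have -> : s * n * (c * l) = n * c * (s * l) by ring.
  by rewrite (pmulr_rgt0 _ n0).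
have zero (K : hline R) : line_ok K -> lfun K z0 != 0 -> forall p, inH p ->
    lform (scalev (Num.sg (lfun K z0)) (lnormal K)) (emb p) = 0 -> on_line K p.
  move=> okK K0 p hp; rewrite lformZl => /eqP.
  rewrite mulf_eq0 sgr_eq0 (negbTE K0) /= => /eqP E; split => //.
  by rewrite lfunE // E mulr0.
apply: (@disjoint_lform _ _ z0) => //.
- by rewrite lformZl lformZr mulrA -expr2 sgn // mul1r lnormal_norm.
- by rewrite lformZl lformZr mulrA -expr2 sgn // mul1r lnormal_norm.
- by apply: pos; rewrite // -expr2 exprn_even_gt0.
- by apply: pos; rewrite // -expr2 exprn_even_gt0.
- by move=> p hp /(zero _ ok nz _ hp) /h' ?; apply: pos.
- by move=> p hp /(zero _ ok' nz' _ hp) /h ?; apply: pos.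
Qed.

(** By [dotp_lgrad] the lengths of the gradients cancel from the angle condition. *)
Lemma cond_angle_lform L L' z0 :
  line_ok L -> line_ok L' -> inH z0 -> cond_angle L L' z0 ->
  [/\ lfun L z0 != 0, lfun L' z0 != 0 & exists2 m, (2 <= m)%N &
    Num.sg (lfun L z0) * Num.sg (lfun L' z0) * lform (lnormal L) (lnormal L')
      = - cos (pi / m%:R)].
Proof.
move=> ok ok' hz [m [p [m2 [hp [hp' [nz [nz' E]]]]]]]; split => //.
exists m => //; move: E; rewrite sgrM (dotp_lgrad ok ok' hp hp').
have N (K : hline R) : line_ok K -> on_line K p -> 0 < enorm (lgrad K p).
  move=> okK [hK _]; rewrite sqrtr_gt0 /dotp; case: K okK => [a|a r] /= _.
    by rewrite mulr0 mulr1 addr0.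
  by rewrite -!expr2 sqnorm_gt0 // mulr_gt0.
move: (N _ ok hp) (N _ ok' hp').
move: (enorm _) (enorm _) (Num.sg _) (Num.sg _) (lform _ _) => c c' s s' l c0 c'0 E.
have cc : c * c' != 0 by rewrite mulf_neq0 ?gt_eqF.
by apply: (mulfI cc); rewrite mulrN -mulNr [c * c']mulrC -E; ring.
Qed.

End Hyperboloid.

(** * Compactness and the Klein disk *)

Section Convergence.
Variable R : realType.

(** Two successive extractions. The form [n <= f n] with a Cauchy condition supplies two arbitrarily
    late terms that are close, which is what contradicts separation. *)
Lemma bolzano_weierstrass_pt (z : nat -> pt R) (C : R) :
  (forall m, `|(z m).1| <= C) -> (forall m, `|(z m).2| <= C) ->
  exists2 f : nat -> nat, (forall n, (n <= f n)%N) &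
    forall eps, 0 < eps -> exists N, forall n n', (N <= n)%N -> (N <= n')%N ->
      `|(z (f n)).1 - (z (f n')).1| <= eps /\ `|(z (f n)).2 - (z (f n')).2| <= eps.
Proof.
move=> h1 h2.
have bnd (u : nat -> R) : (forall m, `|u m| <= C) -> bounded_fun u.
  by move=> hu; exists C; split; rewrite ?num_real // => M CM m _;
    apply: le_trans (hu m) (ltW CM).
have [f finc /cvg_ex[/= l fl]] := bolzano_weierstrass (bnd _ h1).
have [g ginc /cvg_ex[/= l' gl]] :=
  bolzano_weierstrass (bnd (fun n => (z (f n)).2) (fun n => h2 _)).
have inc_ge (k : nat -> nat) : increasing_seq k -> forall n, (n <= k n)%N.
  move=> kinc; elim=> // n IH; apply: leq_ltn_trans IH _.
  by have := leW_mono kinc n n.+1; rewrite !ltEnat /= ltnSn.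
exists (f \o g) => [n /=|eps e0].
  by rewrite (leq_trans (inc_ge _ ginc n)) // inc_ge.
have e2 : 0 < eps / 2 by rewrite divr_gt0.
have [N1 _ H1] : \forall n \near \oo, `|l - (z (f n)).1| < eps / 2.
  by move/cvgrPdist_lt: fl; apply.
have [N2 _ H2] : \forall n \near \oo, `|l' - (z (f (g n))).2| < eps / 2.
  by move/cvgrPdist_lt: gl; apply.
exists (maxn N1 N2) => n n'; rewrite !geq_max => /andP[n1 n2] /andP[n1' n2'].
have tri (a b c : R) : `|c - a| < eps / 2 -> `|c - b| < eps / 2 -> `|a - b| <= eps.
  move=> ha hb; rewrite (le_trans (ler_distD c _ _)) // distrC.
  by rewrite (splitr eps) lerD // ltW.
have ge := inc_ge _ ginc.
split; [apply: (tri _ _ l); apply: H1|apply: (tri _ _ l'); apply: H2] => //=.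
- exact: leq_trans n1 (ge n).
- exact: leq_trans n1' (ge n').
Qed.

(** A hyperbolic ball lies in a Euclidean box that stays away from the real axis, where Euclidean
    closeness implies hyperbolic closeness. *)
Lemma hdist_ball_bounds (z0 z : pt R) (M : R) : inH z0 -> inH z -> hdist z0 z <= M ->
  [/\ z0.2 / (2 * M) <= z.2, z.2 <= 2 * M * z0.2 & `|z.1 - z0.1| <= 2 * M * z0.2].
Proof.
rewrite /inH => y0 y hM; have M1 : 1 <= M by apply: le_trans hM; exact: hdist_ge1.
move: hM; rewrite hdistE // -lerBrDl ler_pdivrMr ?mulr_gt0 // => hM.
have sx := sqr_ge0 (z0.1 - z.1); have sy := sqr_ge0 (z0.2 - z.2).
have yu : z.2 <= 2 * M * z0.2.
  by rewrite -(ler_pM2r y); have := sqr_ge0 z0.2; nra.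
split=> //.
  have M0 : 0 < M by apply: lt_le_trans M1.
  rewrite ler_pdivrMr ?mulr_gt0 // -(ler_pM2l y0).
  by have := sqr_ge0 z.2; nra.
have A : 0 <= 2 * M * z0.2.
  by rewrite mulr_ge0 ?(ltW y0) // mulr_ge0 // (le_trans ler01).
suff : `|z.1 - z0.1| ^+ 2 <= (2 * M * z0.2) ^+ 2. by rewrite ler_sqr ?nnegrE.
rewrite real_normK ?num_real //.
have : (M - 1) * (2 * z0.2 * z.2) <= (M - 1) * (2 * z0.2 * (2 * M * z0.2)).
  by rewrite ler_wpM2l ?subr_ge0 // ler_wpM2l // mulr_ge0 // ltW.
by have := sqr_ge0 z0.2; nra.
Qed.

(* [(klein1 z, klein2 z)] is the point [z] in the Klein disk, and [height z]
   the time coordinate in the hyperboloid model. *)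
Definition height (z : pt R) : R := (1 + (z.1 ^+ 2 + z.2 ^+ 2)) / (2 * z.2).
Definition klein1 (z : pt R) : R := 2 * z.1 / (1 + (z.1 ^+ 2 + z.2 ^+ 2)).
Definition klein2 (z : pt R) : R := 1 - 2 / (1 + (z.1 ^+ 2 + z.2 ^+ 2)).

Lemma one_sqnorm_gt0 (z : pt R) : 0 < 1 + (z.1 ^+ 2 + z.2 ^+ 2).
Proof. by rewrite ltr_pwDl // addr_ge0 ?sqr_ge0. Qed.

Lemma one_sub_klein2 (z : pt R) :
  1 - klein2 z = 2 / (1 + (z.1 ^+ 2 + z.2 ^+ 2)).
Proof. by rewrite /klein2 opprB addrC subrK. Qed.

Lemma height_gt0 z : inH z -> 0 < height z.
Proof. by move=> h; rewrite divr_gt0 ?one_sqnorm_gt0 // mulr_gt0. Qed.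

(** With heights [t] and [t'] the left side equals [2 hdist / (t t') - 1 / t^2 - 1 / t'^2]. *)
Lemma klein_dist (z z' : pt R) : inH z -> inH z' ->
  (klein1 z - klein1 z') ^+ 2 + (klein2 z - klein2 z') ^+ 2
  <= 2 * hdist z z' / (height z * height z').
Proof.
move=> h h'; have t := height_gt0 h; have t' := height_gt0 h'.
have -> : (klein1 z - klein1 z') ^+ 2 + (klein2 z - klein2 z') ^+ 2
    = 2 * hdist z z' / (height z * height z')
      - ((height z)^-1 ^+ 2 + (height z')^-1 ^+ 2).
  have := one_sqnorm_gt0 z; have := one_sqnorm_gt0 z'.
  rewrite (hdistE h h'); move: h h'; rewrite /inH /klein1 /klein2 /height.
  case: z z' {t t'} => [x y] [x' y'] /= /lt0r_neq0 y0 /lt0r_neq0 y0'.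
  move=> /lt0r_neq0 s' /lt0r_neq0 s.
  by field; rewrite y0 y0' s s'.
by rewrite lerBlDr lerDl addr_ge0 ?sqr_ge0.
Qed.

(** [height] is the [hdist] from the point [i], so a change of base point costs only a constant
    factor. *)
Lemma hdist_le_height (z0 : pt R) : inH z0 ->
  exists2 K, 0 < K & forall z, inH z -> hdist z0 z <= K * height z.
Proof.
case: z0 => [x0 y0]; rewrite /inH /= => h0.
have P : 0 < 2 + 2 * x0 ^+ 2 + y0 ^+ 2.
  by have := sqr_ge0 x0; have := sqr_ge0 y0; lra.
exists ((2 + 2 * x0 ^+ 2 + y0 ^+ 2) / y0); first by rewrite divr_gt0.
move=> [x y] h; rewrite hdistE // /height /=; rewrite /inH /= in h.
have -> : 1 + ((x0 - x) ^+ 2 + (y0 - y) ^+ 2) / (2 * y0 * y)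
    = ((x0 - x) ^+ 2 + y0 ^+ 2 + y ^+ 2) / (2 * y0 * y).
  by field; rewrite (lt0r_neq0 h0) (lt0r_neq0 h).
have -> : (2 + 2 * x0 ^+ 2 + y0 ^+ 2) / y0 * ((1 + (x ^+ 2 + y ^+ 2)) / (2 * y))
    = (2 + 2 * x0 ^+ 2 + y0 ^+ 2) * (1 + (x ^+ 2 + y ^+ 2)) / (2 * y0 * y).
  by field; rewrite (lt0r_neq0 h0) (lt0r_neq0 h).
rewrite ler_pM2r ?invr_gt0 ?mulr_gt0 //.
have : 0 <= (2 * x0 ^+ 2 + y0 ^+ 2) * (x ^+ 2 + y ^+ 2).
  by have := sqr_ge0 x0; have := sqr_ge0 y0; have := sqr_ge0 x;
    have := sqr_ge0 y => *; apply: mulr_ge0; lra.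
by have := sqr_ge0 (x0 + x); have := sqr_ge0 x; have := sqr_ge0 y; lra.
Qed.

(** * Boundary limits from distance estimates *)

Section BoundaryLimit.
Variables (z : nat -> pt R) (d : R).
Hypothesis hz : forall m, inH (z m).
Hypothesis d1 : 1 < d.
Hypothesis hdist_mono : forall m n, (m <= n)%N -> hdist (z 0%N) (z m) <= hdist (z 0%N) (z n).
Hypothesis hdist_le : forall m n, (m <= n)%N -> hdist (z m) (z n) <= hdist (z 0%N) (z n).
Hypothesis hdist_sep : forall m, exists n0, forall n, (n0 <= n)%N -> d <= hdist (z m) (z n).

(** A bounded sequence would have two late terms that are Euclidean close at height at least [c],
    hence at [hdist] below [d]. *)
Lemma hdist_unbounded (M : R) : exists m, M < hdist (z 0%N) (z m).
Proof.
apply: contrapT => /forallNP h.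
have {}h m : hdist (z 0%N) (z m) <= M by rewrite leNgt; apply/negP/h.
have y0 := hz 0%N; rewrite /inH in y0.
have M1 : 1 <= M by apply: le_trans (h 0%N); exact: hdist_ge1.
have B m := hdist_ball_bounds (hz 0%N) (hz m) (h m).
pose C := `|(z 0%N).1| + 2 * M * (z 0%N).2.
have C0 : 0 <= 2 * M * (z 0%N).2.
  by rewrite mulr_ge0 ?(ltW y0) // mulr_ge0 // (le_trans ler01).
have [||f fge cau] := @bolzano_weierstrass_pt z C.
- move=> m; have [_ _ b] := B m; rewrite -[(z m).1](subrK (z 0%N).1) addrC.
  by rewrite (le_trans (ler_normD _ _)) // lerD.
- move=> m; have [_ b _] := B m; rewrite ger0_norm; last by rewrite ltW // (hz m).
  by rewrite (le_trans b) // lerDr.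
pose c := (z 0%N).2 / (2 * M).
have c0 : 0 < c by rewrite divr_gt0 // mulr_gt0 // (lt_le_trans ltr01).
(* The cap [1] gives [a^2 <= |a|]; the other bound makes the two squares add up to at most
   [c^2 (d - 1)], less than [2 c^2 (d - 1)]. *)
pose eps := Num.min 1 (c ^+ 2 * (d - 1) / 2).
have e0 : 0 < eps by rewrite lt_min ltr01 divr_gt0 // mulr_gt0 ?exprn_gt0 // subr_gt0.
have [N hN] := cau _ e0.
have [n0 hn0] := hdist_sep (f N).
pose n := maxn N n0.
have [] := hN N n (leqnn _) (leq_maxl _ _).
have := hn0 (f n) (leq_trans (leq_maxr N n0) (fge n)).
have [b1 _ _] := B (f N); have [b2 _ _] := B (f n).
rewrite hdistE //; rewrite -/c in b1 b2.
move: b1 b2; set p := z (f N); set q := z (f n) => b1 b2.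
rewrite -lerBlDl ler_pdivlMr; last by rewrite !mulr_gt0 // ?(hz (f N)) // ?(hz (f n)).
move=> D e1 e2.
have sq (a : R) : `|a| <= eps -> a ^+ 2 <= c ^+ 2 * (d - 1) / 2.
  move=> ha; rewrite -real_normK ?num_real //.
  have ha1 : `|a| <= 1 by rewrite (le_trans ha) // ge_min lexx.
  have ha2 : `|a| <= c ^+ 2 * (d - 1) / 2 by rewrite (le_trans ha) // ge_min lexx orbT.
  by rewrite expr2 (le_trans _ ha2) // ler_piMl.
have cc : c ^+ 2 <= p.2 * q.2 by rewrite expr2 ler_pM // ltW.
have : (d - 1) * (2 * c ^+ 2) <= (d - 1) * (2 * p.2 * q.2).
  by rewrite ler_wpM2l ?subr_ge0 ?(ltW d1) // -mulrA ler_wpM2l.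
have : 0 < (d - 1) * c ^+ 2 by rewrite mulr_gt0 ?exprn_gt0 // subr_gt0.
by have := sq _ e1; have := sq _ e2; lra.
Qed.

Lemma inv_height_cvg0 : (fun m => (height (z m))^-1) @ \oo --> 0.
Proof.
have [K K0 hK] := hdist_le_height (hz 0%N).
apply/cvgrPdist_lt => eps e0.
have [N hN] := hdist_unbounded (K / eps).
exists N => // n /= Nn; rewrite sub0r normrN.
have t0 := height_gt0 (hz n).
rewrite gtr0_norm ?invr_gt0 // invf_plt ?posrE // -(ltr_pM2l K0).
by rewrite (lt_le_trans hN) // (le_trans (hdist_mono Nn)) // hK.
Qed.

(** For [N <= n], [hdist (z N) (z n) <= hdist (z 0) (z n) <= K * height (z n)], so the bound of
    [klein_dist] becomes [2 K / height (z N)], independent of [n]. The function [k] stands for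
    either Klein coordinate. *)
Lemma klein_cauchy (k : pt R -> R) :
  (forall p q, (k p - k q) ^+ 2
    <= (klein1 p - klein1 q) ^+ 2 + (klein2 p - klein2 q) ^+ 2) ->
  cvgn (k \o z).
Proof.
move=> hk; have [K K0 hK] := hdist_le_height (hz 0%N).
apply/cauchy_cvgP/cauchy_exP => eps e0.
have e2 : 0 < eps ^+ 2 / (2 * K) by rewrite divr_gt0 ?exprn_gt0 // mulr_gt0.
have /cvgrPdist_lt/(_ _ e2)[N _ hN] := inv_height_cvg0.
exists (k (z N)), N => // n /= Nn.
have t0 := height_gt0 (hz N); have t1 := height_gt0 (hz n).
have := hN N (leqnn N); rewrite /= sub0r normrN gtr0_norm ?invr_gt0 // => hlt.
rewrite /ball /=; suff : `|k (z N) - k (z n)| ^+ 2 < eps ^+ 2.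
  by rewrite ltr_sqr ?nnegrE // ltW.
rewrite real_normK ?num_real //; apply: le_lt_trans (hk _ _) _.
apply: le_lt_trans (klein_dist (hz N) (hz n)) _.
have : hdist (z N) (z n) <= K * height (z n) by rewrite (le_trans (hdist_le Nn)) ?hK.
move=> hd; have : 2 * hdist (z N) (z n) / (height (z N) * height (z n))
  <= 2 * K / height (z N).
  have -> : 2 * K / height (z N)
      = 2 * (K * height (z n)) / (height (z N) * height (z n)).
    by field; rewrite (lt0r_neq0 t0) (lt0r_neq0 t1).
  by rewrite ler_pM2r ?invr_gt0 ?(mulr_gt0 t0 t1) // ler_pM2l.
move=> /le_lt_trans; apply; rewrite mulrC -ltr_pdivlMr //; exact: mulr_gt0.
Qed.

(** The half-plane coordinates are recovered as [x = klein1 / (1 - klein2)] and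
    [y = 1 / ((1 - klein2) * height)]. *)
Lemma boundary_limit : exists zeta, conv_bdry z zeta.
Proof.
have /cvg_ex[/= a ka] : cvgn (klein1 \o z).
  by apply: klein_cauchy => p q; rewrite lerDl sqr_ge0.
have /cvg_ex[/= b kb] : cvgn (klein2 \o z).
  by apply: klein_cauchy => p q; rewrite lerDr sqr_ge0.
have s0 m := one_sqnorm_gt0 (z m).
have b1 : b <= 1.
  apply: (cvgr_to_le kb); near=> m.
  by rewrite /= /klein2 lerBlDr lerDl divr_ge0 // ltW.
(* The value [klein2 = 1] corresponds to the boundary point at infinity. *)
have [bE|bN] := eqVneq b 1.
  exists None => M; move/cvgrPdist_lt: kb; rewrite bE.
  have M0 : 0 < `|M| + 1 by rewrite ltr_wpDl.
  have e0 : 0 < 2 / (`|M| + 1) by rewrite divr_gt0.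
  move=> /(_ _ e0); apply: filterS => m /=.
  rewrite one_sub_klein2 ger0_norm ?divr_ge0 ?(ltW (s0 m)) //.
  rewrite ltr_pM2l // ltf_pV2 ?posrE // addrC ltrD2l.
  by apply: le_lt_trans; exact: ler_norm.
have b2 : 1 - b != 0 by rewrite subr_eq0 eq_sym.
have ks : (fun m => (1 - klein2 (z m))^-1) @ \oo --> (1 - b)^-1.
  by apply: cvgV => //; apply: cvgB kb; exact: cvg_cst.
exists (Some (a / (1 - b))); split.
  rewrite (_ : (fun m => (z m).1) = fun m => klein1 (z m) * (1 - klein2 (z m))^-1).
    exact: cvgM.
  apply/funext => m; have := s0 m => /lt0r_neq0 sm.
  by rewrite one_sub_klein2 /klein1; field.
rewrite (_ : (fun m => (z m).2)
  = fun m => (1 - klein2 (z m))^-1 * (height (z m))^-1).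
  rewrite -[0](mulr0 (1 - b)^-1).
  by apply: cvgM => //; exact: inv_height_cvg0.
apply/funext => m; have := s0 m => /lt0r_neq0 sm.
by rewrite one_sub_klein2 /height; field; rewrite (inH_neq0 (hz m)).
Unshelve. all: by end_near.
Qed.

End BoundaryLimit.
End Convergence.

(** * Chebyshev polynomials at [cos (pi / m)] and beyond [1] *)

Section Chebyshev.
Variable R : realType.
Implicit Types (c : R) (k m : nat).

(* Chebyshev polynomials of the second kind, shifted: [cheb (cos t) k] is
   [sin (k t) / sin t]. *)
Fixpoint cheb c k : R :=
  match k with
  | 0 => 0
  | k'.+1 => if k' is k''.+1 then 2 * c * cheb c k' - cheb c k'' else 1
  end.

(** The predecessor term, extended to [k = 0] by [sin (- t) / sin t = -1], so that the recurrence
    holds from the start. *)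
Definition chebP c k : R := if k is k'.+1 then cheb c k' else -1.

Lemma chebS c k : cheb c k.+1 = 2 * c * cheb c k - chebP c k.
Proof. by case: k => [|k] //=; rewrite mulr0 sub0r opprK. Qed.

(** For [c >= 1] the sequence increases by at least one at each step. *)
Lemma cheb_gt0 c k : 1 <= c -> 0 < cheb c k.+1.
Proof.
move=> c1; suff : 0 <= cheb c k /\ cheb c k + 1 <= cheb c k.+1 by case; lra.
elim: k => [|k [h1 h2]]; first by rewrite /= add0r.
have h3 : 0 <= cheb c k.+1 by lra.
split=> //; rewrite [cheb c k.+2]chebS /chebP -mulrA.
have : cheb c k.+1 <= c * cheb c k.+1 by rewrite ler_peMl.
by lra.
Qed.

Lemma cheb_sin t k : cheb (cos t) k * sin t = sin (k%:R * t).
Proof.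
suff : cheb (cos t) k * sin t = sin (k%:R * t) /\
       cheb (cos t) k.+1 * sin t = sin (k.+1%:R * t) by case.
elim: k => [|k [h1 h2]]; first by rewrite /= !mul0r sin0 !mul1r.
split=> //; rewrite chebS /chebP mulrBl h1 -!mulrA h2.
have -> : k.+2%:R * t = k.+1%:R * t + t by rewrite -[k.+2]addn1 natrD mulrDl mul1r.
have -> : k%:R * t = k.+1%:R * t - t by rewrite -[k.+1]addn1 natrD mulrDl mul1r addrK.
by rewrite sinB sinD; ring.
Qed.

(** Here [t = pi / m], and [sin (k t)] is positive for [0 < k < m] and vanishes at [k = m]. *)
Lemma cheb_pi m : (2 <= m)%N -> let c := cos (pi / m%:R) in
  [/\ 0 <= c < 1, forall k, (0 < k < m)%N -> 0 < cheb c k,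
      cheb c m = 0, cheb c m.+1 = -1 & chebP c m = 1].
Proof.
move=> m2 c; set t : R := pi / m%:R.
have pi0 := pi_gt0 R.
have m0 : 0 < m%:R :> R by rewrite ltr0n; lia.
have t0 : 0 < t by rewrite divr_gt0.
have t2 : t <= pi / 2 by rewrite ler_pM2l // lef_pV2 ?posrE ?ler_nat.
have st : 0 < sin t by apply: sin_gt0_pi; rewrite t0 /=; lra.
have mt : m%:R * t = pi by rewrite /t mulrC divfK // gt_eqF.
have E := cheb_sin t.
have cm : cheb c m = 0.
  by apply: (mulIf (lt0r_neq0 st)); rewrite E mt sinpi mul0r.
have cmS : cheb c m.+1 = -1.
  apply: (mulIf (lt0r_neq0 st)); rewrite E -addn1 natrD mulrDl mt mul1r.
  by rewrite sinD sinpi cospi; ring.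
split=> //.
- apply/andP; split; first by apply: cos_ge0_pihalf; rewrite -/t t2 andbT; lra.
  have := cos2Dsin2 t; rewrite -/c => h.
  have := cos_le1 t; rewrite -/c => h'.
  have s0 : 0 < sin t ^+ 2 by rewrite exprn_gt0.
  by rewrite lt_neqAle h' andbT; apply/eqP => c1; move: h; rewrite c1; lra.
- move=> k /andP[k0 km]; rewrite -(pmulr_lgt0 _ st) E.
  apply: sin_gt0_pi; rewrite -mt ltr_pM2r // ltr_nat km andbT.
  by rewrite pmulr_lgt0 // ltr0n.
- by have := chebS c m; rewrite cmS cm mulr0 sub0r => /oppr_inj.
Qed.
End Chebyshev.
Arguments cheb : simpl never.

(** * The reflection group acting on the half-plane *)

Section Coxeter.
Variables (R : realType) (L : 'I_3 -> hline R) (e : 'I_3 -> vec R) (z0 : pt R).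
Hypothesis okL : forall i, line_ok (L i).
Hypothesis hz0 : inH z0.
Hypothesis e_norm : forall i, lform (e i) (e i) = 1.
Hypothesis e_refl : forall i z v, inH z ->
  lform v (emb (refl (L i) z))
  = lform v (emb z) - 2 * lform (e i) (emb z) * lform v (e i).
Hypothesis e_pos : forall i, 0 < lform (e i) (emb z0).
Hypothesis e_gram : forall i j, i != j -> lform (e i) (e j) <= -1 \/
  exists2 m, (2 <= m)%N & lform (e i) (e j) = - cos (pi / m%:R).
Implicit Types (w : seq 'I_3) (z : pt R).

Local Notation g := (fun i z => lform (e i) (emb z)).

Lemma g_refl i z : inH z -> g i (refl (L i) z) = - g i z.
Proof. by move=> hz /=; rewrite e_refl // e_norm; ring. Qed.

Lemma reflK i z : inH z -> refl (L i) (refl (L i) z) = z.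
Proof.
move=> hz; have hr := inH_refl (okL i) hz.
apply: emb_inj => //; first exact: inH_refl.
by move=> v; rewrite e_refl // e_refl // (g_refl i hz); ring.
Qed.

Lemma hdist_refl i z z' : inH z -> inH z' ->
  hdist (refl (L i) z) (refl (L i) z') = hdist z z'.
Proof.
move=> hz hz'; rewrite /hdist e_refl // [lform _ (emb z')]lformC e_refl //.
rewrite [lform (emb (refl _ _)) _]lformC (g_refl i hz).
by rewrite (lformC (emb z') (emb z)) (lformC (emb z') (e i)); ring.
Qed.

Lemma act_cat w w' z : act L (w ++ w') z = act L w (act L w' z).
Proof. by rewrite /act foldr_cat. Qed.

Lemma inH_act w z : inH z -> inH (act L w z).
Proof. by move=> hz; elim: w => //= i w; exact: inH_refl. Qed.

Lemma hdist_act w z z' : inH z -> inH z' ->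
  hdist (act L w z) (act L w z') = hdist z z'.
Proof. by move=> hz hz'; elim: w => //= i w <-; rewrite hdist_refl //; exact: inH_act. Qed.

Lemma act_rcons w i z : act L (rcons w i) z = act L w (refl (L i) z).
Proof. by rewrite -cats1 act_cat. Qed.

Lemma act_revK w z : inH z -> act L (rev w) (act L w z) = z.
Proof.
move=> hz; elim: w => [|i w IH] //=; rewrite rev_cons act_rcons reflK //.
exact: inH_act.
Qed.

Lemma word_eq_sym w w' : word_eq L w w' -> word_eq L w' w.
Proof. by move=> h z hz; rewrite h. Qed.

Lemma word_eq_trans w w' w'' : word_eq L w w' -> word_eq L w' w'' -> word_eq L w w''.
Proof. by move=> h h' z hz; rewrite h // h'. Qed.

Lemma word_eq_cat w1 w1' w2 w2' : word_eq L w1 w1' -> word_eq L w2 w2' ->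
  word_eq L (w1 ++ w2) (w1' ++ w2').
Proof. by move=> h1 h2 z hz; rewrite !act_cat h2 // h1 //; exact: inH_act. Qed.

Lemma word_eq_rcons w w' i : word_eq L w w' -> word_eq L (rcons w i) (rcons w' i).
Proof. by move=> h; rewrite -!cats1; exact: word_eq_cat. Qed.

Lemma word_eq_rev w w' : word_eq L w w' -> word_eq L (rev w) (rev w').
Proof.
move=> h z hz; have hr := inH_act (rev w') hz.
by rewrite -[RHS](act_revK w hr) h // -{1}[w']revK act_revK.
Qed.

Lemma word_eq_rcons2 w i : word_eq L (rcons (rcons w i) i) w.
Proof. by move=> z hz; rewrite !act_rcons reflK. Qed.

(** * Word length *)

Lemma ell_leq w w' : word_eq L w w' -> (ell L w <= size w')%N.
Proof.
move=> h; rewrite /ell; case: ex_minnP => n _; apply.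
by apply/asboolP; exists w'.
Qed.

Lemma ell_witness w : exists2 w', word_eq L w w' & size w' = ell L w.
Proof.
rewrite /ell; case: ex_minnP => n /asboolP[w' [h1 h2]] _; by exists w'.
Qed.

Lemma ell_leq_word w w' : word_eq L w w' -> (ell L w <= ell L w')%N.
Proof.
move=> h; have [v hv <-] := ell_witness w'.
by apply: ell_leq; exact: word_eq_trans hv.
Qed.

Lemma ell_word w w' : word_eq L w w' -> ell L w = ell L w'.
Proof.
by move=> h; apply/eqP; rewrite eqn_leq !ell_leq_word //; exact: word_eq_sym.
Qed.

Lemma ell_size w : (ell L w <= size w)%N.
Proof. exact: ell_leq. Qed.

Lemma ell_rev w : ell L (rev w) = ell L w.
Proof.
have H u : (ell L (rev u) <= ell L u)%N.
  have [v hv <-] := ell_witness u.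
  by rewrite -size_rev; apply/ell_leq/word_eq_rev.
by apply/eqP; rewrite eqn_leq H -{1}[w]revK H.
Qed.

Lemma ell_cat w w' : (ell L (w ++ w') <= ell L w + size w')%N.
Proof.
have [v hv <-] := ell_witness w.
by rewrite -size_cat; apply: ell_leq; exact: word_eq_cat.
Qed.

Lemma ell_catl w w' : (ell L (w ++ w') <= size w + ell L w')%N.
Proof. by rewrite -ell_rev rev_cat (leq_trans (ell_cat _ _)) // ell_rev size_rev addnC. Qed.

Lemma ell_rcons w i : (ell L (rcons w i) <= (ell L w).+1)%N.
Proof. by rewrite -cats1 (leq_trans (ell_cat _ _)) // addn1. Qed.

(** * Alternating words, dihedral subgroups and ascents *)

Fixpoint alt k (i j : 'I_3) : seq 'I_3 :=
  if k is k'.+1 then rcons (alt k' j i) j else [::].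

Lemma size_alt k i j : size (alt k i j) = k.
Proof. by elim: k i j => //= k IH i j; rewrite size_rcons IH. Qed.

Lemma alt_cat r m i j :
  alt (r + m) i j = (if odd m then alt r j i else alt r i j) ++ alt m i j.
Proof.
elim: m i j => [|m IH] i j; first by rewrite addn0 cats0.
by rewrite addnS /= IH -rcons_cat; case: (odd m).
Qed.

(** The products with [e i] and [e j] evolve by the Chebyshev recurrence. For [k > 0], [f] is the
    first letter of the alternating word and [s] the other one. *)
Lemma g_alt k i j z : inH z -> let c := - lform (e i) (e j) in
  let f := if odd k then j else i in let s := if odd k then i else j in
  g i (act L (rev (alt k i j)) z) = cheb c k.+1 * g f z + cheb c k * g s z /\
  g j (act L (rev (alt k i j)) z) = - (cheb c k * g f z + chebP c k * g s z).
Proof.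
move=> hz; elim: k i j => [|k IH] i j c f s /=.
  by rewrite /f /s /cheb /chebP /=; split; ring.
rewrite rev_rcons /=; have := IH j i; rewrite /= (lformC (e j) (e i)) -/c.
have -> : (if odd k then i else j) = f by rewrite /f /=; case: (odd k).
have -> : (if odd k then j else i) = s by rewrite /s /=; case: (odd k).
set y := act _ _ _ => -[h1 h2].
have hy : inH y by exact: inH_act.
rewrite (g_refl j hy) e_refl // h1 h2; split=> //.
rewrite (_ : lform (e i) (e j) = - c); last by rewrite opprK.
rewrite (_ : cheb c k.+2 = 2 * c * cheb c k.+1 - cheb c k) //.
by rewrite [cheb c k.+1]chebS; ring.
Qed.

Lemma emb_alt k i j z : inH z -> exists a b, forall v,
  lform v (emb (act L (rev (alt k i j)) z))
  = lform v (emb z) + a * lform v (e i) + b * lform v (e j).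
Proof.
move=> hz; elim: k i j => [|k IH] i j; first by exists 0, 0 => v /=; ring.
have [a [b h]] := IH j i; rewrite /= rev_rcons /=; set y := act _ _ _ in h *.
exists b, (a - 2 * g j y) => v; rewrite e_refl ?h; last exact: inH_act.
by rewrite /=; ring.
Qed.

(** Both sides move [emb z] by combinations of [e i] and [e j], and [g_alt] gives them equal
    products with these two normals. Their Gram matrix is invertible since [c^2 < 1], so the
    combinations agree. *)
Lemma braid m i j : (2 <= m)%N -> lform (e i) (e j) = - cos (pi / m%:R) ->
  word_eq L (alt m i j) (alt m j i).
Proof.
move=> m2 hc; suff H : word_eq L (rev (alt m i j)) (rev (alt m j i)).
  by rewrite -[alt m i j]revK -[alt m j i]revK; exact: word_eq_rev.
move=> z hz; have [c01 _ cm cmS cmP] := cheb_pi R m2.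
have [a [b h]] := emb_alt m i j hz; have [a' [b' h']] := emb_alt m j i hz.
have [] := g_alt m i j hz; have [] := g_alt m j i hz.
rewrite /= (lformC (e j) (e i)) hc opprK cm cmS cmP !mul0r !addr0 !add0r !mul1r !mulN1r.
rewrite !h !h' !e_norm (lformC (e j) (e i)) hc.
move: c01; set c := cos _ => c01 E1 E2 E3 E4.
have p1 : (a - b') - c * (b - a') = 0 by lra.
have p2 : (b - a') - c * (a - b') = 0 by lra.
have c2 : 1 - c ^+ 2 != 0 by rewrite gt_eqF //; nra.
have p3 : (1 - c ^+ 2) * (a - b') = 0.
  have -> : (1 - c ^+ 2) * (a - b')
      = ((a - b') - c * (b - a')) + c * ((b - a') - c * (a - b')) by ring.
  by rewrite p1 p2 mulr0 addr0.
have /eqP := p3; rewrite mulf_eq0 (negbTE c2) /= subr_eq0 => /eqP Ea.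
have Eb : b = a' by move: p2; rewrite Ea; lra.
apply: emb_inj; [exact: inH_act|exact: inH_act|move=> v].
by rewrite h h' Ea Eb; ring.
Qed.

(* Strip from the right end of [w] the letters [j], [i], [j], ... for as long
   as they are descents. *)
Lemma dihedral_factor n w i j : (ell L w <= n)%N ->
  (ell L w <= ell L (rcons w i))%N ->
  exists v k, [/\ word_eq L w (v ++ alt k i j), ell L w = (ell L v + k)%N,
    (ell L v <= ell L (rcons v i))%N & (ell L v <= ell L (rcons v j))%N].
Proof.
elim: n w i j => [|n IH] w i j hn hi.
  exists w, 0%N; rewrite cats0 addn0; split => //.
  by rewrite (leq_trans hn).
have [hj|hj] := leqP (ell L w) (ell L (rcons w j)).
  by exists w, 0%N; rewrite cats0 addn0; split.
have e2 := ell_word (word_eq_rcons2 w j).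
have e1 := ell_rcons (rcons w j) j; rewrite e2 in e1.
have ew : ell L w = (ell L (rcons w j)).+1 by apply/eqP; rewrite eqn_leq e1 hj.
have [||v [k [h1 h2 h3 h4]]] := IH (rcons w j) j i.
- by rewrite -ltnS (leq_trans hj).
- by rewrite e2 ltnW.
exists v, k.+1; split => //; last by rewrite ew h2 addnS.
apply: word_eq_trans (word_eq_sym (word_eq_rcons2 w j)) _.
by rewrite /= -rcons_cat; exact: word_eq_rcons.
Qed.

(** Induction on length: in the dihedral factorisation [v] is shorter, and [g_alt] gives a
    combination with nonnegative coefficients of two products that are positive by induction. *)
Lemma ascent_pos w i : (ell L w <= ell L (rcons w i))%N ->
  0 < g i (act L (rev w) z0).
Proof.
have [n] := ubnP (ell L w); elim: n w i => // n IH w i hn hi.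
have [w' hw' sw'] := ell_witness w.
case/lastP: w' hw' sw' => [|w' j] hw' sw'.
  by have := word_eq_rev hw' => /(_ z0 hz0) /= ->.
(* The last letter of a shortest word is a descent; this makes the alternating factor nonempty. *)
have hj : (ell L (rcons w j) < ell L w)%N.
  rewrite -sw' size_rcons ltnS; apply: ell_leq.
  exact: word_eq_trans (word_eq_rcons j hw') (word_eq_rcons2 w' j).
have ij : i != j by apply: contraTneq hi => ->; rewrite -ltnNge.
have [v [k [h1 h2 h3 h4]]] := dihedral_factor j (leqnn _) hi.
have k0 : (0 < k)%N.
  rewrite lt0n; apply: contraTneq hj => k0; rewrite -leqNgt.
  move: h1 h2; rewrite k0 cats0 addn0 => h1 ->.
  by rewrite (ell_word (word_eq_rcons j h1)).
have vn : (ell L v < n)%N by lia.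
have := word_eq_rev h1 => /(_ z0 hz0) /= ->.
have hv := inH_act (rev v) hz0.
rewrite rev_cat act_cat; have [-> _] := g_alt k i j hv.
have Pi := IH _ _ vn h3; have Pj := IH _ _ vn h4.
have {Pi Pj} P l : l \in [:: i; j] -> 0 < g l (act L (rev v) z0).
  by rewrite !inE => /orP[] /eqP ->.
have Pf : 0 < g (if odd k then j else i) (act L (rev v) z0).
  by apply: P; rewrite !inE; case: ifP; rewrite eqxx ?orbT.
have Ps : 0 < g (if odd k then i else j) (act L (rev v) z0).
  by apply: P; rewrite !inE; case: ifP; rewrite eqxx ?orbT.
case: (e_gram ij) => [ha|[m m2 ha]].
  have c1 : 1 <= - lform (e i) (e j) by lra.
  by rewrite -(prednK k0) in Pf Ps *; rewrite addr_gt0 // mulr_gt0 // cheb_gt0.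
have [_ cpos cm _ _] := cheb_pi R m2; rewrite ha opprK.
(* Otherwise the braid relation would let the factor end in [i], which cancels against the appended
   [i] and makes [rcons w i] shorter than [w]. *)
have km : (k < m)%N.
  rewrite ltnNge; apply: contraTN hi => mk; rewrite -ltnNge.
  have := braid m2 ha; move: h1; rewrite -(subnK mk) alt_cat.
  set r := if _ then _ else _ => h1 hb.
  have sr : size r = (k - m)%N by rewrite /r; case: ifP; rewrite size_alt.
  have h : word_eq L (rcons w i) (v ++ (r ++ alt m.-1 i j)).
    apply: word_eq_trans (word_eq_rcons i h1) _.
    apply: (@word_eq_trans _ (rcons (v ++ (r ++ alt m j i)) i)).
      by apply/word_eq_rcons/word_eq_cat => //; apply: word_eq_cat.
    rewrite -[in alt m j i](prednK (ltnW m2)) /= -!rcons_cat.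
    exact: word_eq_rcons2.
  rewrite (ell_word h) (leq_ltn_trans (ell_cat _ _)) // size_cat sr size_alt h2.
  by lia.
(* The first coefficient vanishes when [k + 1 = m]; the second is always positive. *)
rewrite ltr_wpDl ?mulr_gt0 ?cpos ?k0 // mulr_ge0 //; last exact: ltW.
have [kmS|kmS] := ltnP k.+1 m; first by rewrite ltW // cpos.
by have -> : k.+1 = m; [lia|rewrite cm].
Qed.

Lemma descent_neg w i : (ell L (rcons w i) <= ell L w)%N ->
  g i (act L (rev w) z0) < 0.
Proof.
move=> h; have := @ascent_pos (rcons w i) i.
rewrite (ell_word (word_eq_rcons2 w i)) => /(_ h).
by rewrite rev_rcons /= (g_refl i (inH_act _ hz0)) oppr_gt0.
Qed.

(** * Distances along reduced words *)

Definition reduced w := ell L w = size w.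

Lemma reduced_catr w w' : reduced (w ++ w') -> reduced w'.
Proof.
rewrite /reduced size_cat => h; have := ell_catl w w'; have := ell_size w'.
by rewrite h; lia.
Qed.

Lemma reduced_cons_pos i w : reduced (i :: w) -> 0 < g i (act L w z0).
Proof.
move=> h; rewrite -[w]revK; apply: ascent_pos.
rewrite -rev_cons !ell_rev h; exact: leq_trans (ell_size w) (leqnSn _).
Qed.

(** The reflection moves a point on the side of [z0] across the line, which adds
    [2 <e i, w z0> <e i, z0> > 0]. *)
Lemma hdist_cons_ge i w : reduced (i :: w) ->
  hdist z0 (act L w z0) <= hdist z0 (act L (i :: w) z0).
Proof.
move=> /reduced_cons_pos h; have hw := inH_act w hz0.
rewrite /hdist /= e_refl // lerN2 lerBlDr lerDl (lformC (emb z0)).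
by rewrite !mulr_ge0 ?ltW // (e_pos i).
Qed.

(** Through [hdist_act_cat] this becomes [d(z_m, z_n) <= d(z0, z_n)] along the process. *)
Lemma hdist_suffix w w' : reduced (w ++ w') ->
  hdist z0 (act L w' z0) <= hdist z0 (act L (w ++ w') z0).
Proof.
elim: w => //= i w IH h; apply: le_trans (hdist_cons_ge h).
by apply: IH; apply: (@reduced_catr [:: i]).
Qed.

Lemma hdist_act_cat w w' : hdist (act L w z0) (act L (w ++ w') z0) = hdist z0 (act L w' z0).
Proof. by rewrite act_cat hdist_act //; exact: inH_act. Qed.

Lemma hdist_rev w : hdist z0 (act L (rev w) z0) = hdist z0 (act L w z0).
Proof.
rewrite -[LHS](hdist_act w) //; last exact: inH_act.
by rewrite -{2}[w]revK act_revK // hdistC.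
Qed.

Lemma reduced_rev w : reduced w -> reduced (rev w).
Proof. by rewrite /reduced ell_rev size_rev. Qed.

Lemma hdist_prefix w w' : reduced (w ++ w') ->
  hdist z0 (act L w z0) <= hdist z0 (act L (w ++ w') z0).
Proof.
move=> /reduced_rev; rewrite rev_cat => /hdist_suffix.
by rewrite -rev_cat !hdist_rev.
Qed.

(** By invariance the distance is that from [z0] to [w' z0], and these points are separated by the
    line of the first letter of [w']. The minimum over the three lines gives a uniform bound. *)
Lemma reduced_separated : exists2 d : R, 1 < d &
  forall w w', reduced (w ++ w') -> w' != [::] ->
    d <= hdist (act L w z0) (act L (w ++ w') z0).
Proof.

pose f (i : 'I_3) := Num.sqrt (1 + lform (e i) (emb z0) ^+ 2).
have f1 i : 1 < f i.
  by rewrite -[1]sqrtr1 ltr_sqrt ?ltrDl ?exprn_gt0 // ltr_wpDl ?ler01 ?exprn_gt0.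
pose d := Num.min (f 0) (Num.min (f 1) (f 2%:R)).
have df i : d <= f i.
  rewrite /d !ge_min; case: i => -[|[|[|//]]] hi.
  - by rewrite (_ : Ordinal hi = 0) ?lexx //; apply: val_inj.
  - by rewrite (_ : Ordinal hi = 1) ?lexx ?orbT //; apply: val_inj.
  - by rewrite (_ : Ordinal hi = 2%:R) ?lexx ?orbT //; apply: val_inj.
exists d; first by rewrite !lt_min !f1.
move=> w [//|i w'] red _; rewrite hdist_act_cat.
have hw := inH_act (i :: w') hz0.
apply: le_trans (df i) _.
rewrite -[leRHS]ger0_norm; last by rewrite (le_trans ler01) // hdist_ge1.
rewrite -sqrtr_sqr ler_wsqrtr // hdist_sqr_ge // mulr_ge0_le0 ?(ltW (e_pos i)) //=.
have hw' := inH_act w' hz0.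
by rewrite (g_refl i hw') oppr_le0 ltW //; apply/reduced_cons_pos/reduced_catr/red.
Qed.

(* Four vectors of a 3-dimensional space are dependent, so some nonzero
   combination of the normals is a multiple of [emb z0], hence not spacelike.
   Since distinct normals have nonpositive products, taking absolute values
   of its coefficients preserves this. *)
Lemma no_opposite_chamber z : inH z -> (forall i, g i z < 0) -> False.
Proof.
move=> hz neg; pose X := emb z0.
have [x [x1 [x2 [y [nz H]]]]] : exists x x1 x2 y : R,
    ~ [/\ x = 0, x1 = 0, x2 = 0 & y = 0] /\ forall v,
    x * lform v (e 0) + x1 * lform v (e 1) + x2 * lform v (e 2%:R)
      + y * lform v X = 0.
  pose co (v : vec R) (j : 'I_3) : R := nth 0 [:: v.1.1; v.1.2; v.2] j.
  pose M : 'M[R]_(4, 3) :=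
    \matrix_(i, j) co (nth X [:: e 0; e 1; e 2%:R] i) j.
  have : kermx M != 0.
    rewrite kermx_eq0 /row_free; apply/negP => /eqP rk.
    by have := rank_leq_col M; rewrite rk.
  case/rowV0Pn => r /sub_kermxP rM r0.
  exists (r 0 (inord 0)), (r 0 (inord 1)), (r 0 (inord 2)), (r 0 (inord 3)).
  have E i : \sum_k r 0 k * co (nth X [:: e 0; e 1; e 2%:R] k) i = 0.
    transitivity ((r *m M) 0 i); last by rewrite rM mxE.
    by rewrite mxE; apply: eq_bigr => k _; rewrite !mxE.
  have O k (hk : (k < 4)%N) : Ordinal hk = inord k :> 'I_4.
    by apply: val_inj; rewrite /= inordK.
  split.
    case=> r1 r2 r3 r4; case/eqP: r0; apply/rowP => -[[|[|[|[|//]]]] hk].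
    - by rewrite O r1 mxE.
    - by rewrite O r2 mxE.
    - by rewrite O r3 mxE.
    - by rewrite O r4 mxE.
  pose C (j : 'I_3) := r 0 (inord 0) * co (e 0) j
    + r 0 (inord 1) * co (e 1) j + r 0 (inord 2) * co (e 2%:R) j
    + r 0 (inord 3) * co X j.
  have C0 j : C j = 0.
    rewrite -[RHS](E j) !big_ord_recl big_ord0 addr0 !addrA.
    by congr (r _ _ * _ + r _ _ * _ + r _ _ * _ + r _ _ * _);
      apply: val_inj; rewrite /= inordK.
  move=> v.
  transitivity (v.1.2 * C (inord 1)
    - (v.1.1 * C (inord 2) + v.2 * C (inord 0)) / 2).
    by rewrite /C /co !inordK //= /lform /X /=; ring.
  by rewrite !C0; ring.
have HX := H X; have H0 := H (e 0); have H1 := H (e 1); have H2 := H (e 2%:R).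
have XX : lform X X = -1 by apply: emb_norm.
have gram i j : i != j -> lform (e i) (e j) <= 0.
  move=> /e_gram[|[m m2 ->]]; first by lra.
  by have [/andP[c0 _] _ _ _ _] := cheb_pi R m2; rewrite oppr_le0.
have a01 := gram 0 1 isT; have a02 := gram 0 2%:R isT; have a12 := gram 1 2%:R isT.
rewrite !(lformC X) XX in HX; rewrite !e_norm in H0 H1 H2.
rewrite (lformC (e 1) (e 0)) in H1.
rewrite (lformC (e 2%:R) (e 0)) (lformC (e 2%:R) (e 1)) in H2.
pose V : vec R :=
  (`|x| * (e 0).1.1 + `|x1| * (e 1).1.1 + `|x2| * (e 2%:R).1.1,
   `|x| * (e 0).1.2 + `|x1| * (e 1).1.2 + `|x2| * (e 2%:R).1.2,
   `|x| * (e 0).2 + `|x1| * (e 1).2 + `|x2| * (e 2%:R).2).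
have EV (w : vec R) : lform V w = `|x| * lform (e 0) w + `|x1| * lform (e 1) w
    + `|x2| * lform (e 2%:R) w by rewrite /V /lform /=; ring.
have sq (p q a : R) : a <= 0 -> `|p| * `|q| * a <= p * q * a.
  by move=> a0; rewrite ler_wnM2r // -normrM ler_norm.
(* The signed combination is [- y X], of norm [- y^2]; the norm of [V] is at most this. *)
have QV : lform V V <= 0.
  rewrite EV !(lformC _ V) !EV !e_norm (lformC (e 1) (e 0)).
  rewrite (lformC (e 2%:R) (e 0)) (lformC (e 2%:R) (e 1)).
  have n2 (p : R) : `|p| * `|p| = p * p by rewrite -normrM ger0_norm // -expr2 sqr_ge0.
  have := n2 x; have := n2 x1; have := n2 x2.
  have := sq x x1 _ a01; have := sq x x2 _ a02; have := sq x1 x2 _ a12.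
  have T0 := congr1 (fun t => x * t) H0; have T1 := congr1 (fun t => x1 * t) H1.
  have T2 := congr1 (fun t => x2 * t) H2; have TX := congr1 (fun t => y * t) HX.
  by have := sqr_ge0 y; rewrite !mulr0 in T0 T1 T2 TX; lra.
have ge i (t : R) : 0 <= `|t| * lform (e i) X by apply/mulr_ge0/ltW/e_pos.
have pos : 0 < lform V X.
  rewrite EV lt_neqAle !addr_ge0 ?ge // andbT eq_sym.
  rewrite !paddr_eq0 ?addr_ge0 ?ge // !mulf_eq0 !normr_eq0.
  have gz i : (lform (e i) X == 0) = false by rewrite gt_eqF // (e_pos i).
  rewrite !gz !orbF; apply/negP => /andP[/andP[/eqP x00 /eqP x10] /eqP x20].
  by apply: nz; split => //; move: HX; rewrite x00 x10 x20; lra.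
(* [V] would be positive at [z] as it is at [z0], yet each of its terms is nonpositive at [z]. *)
have := causal_sign QV hz0 hz pos; rewrite EV ltNge => /negP; apply.
have le i (t : R) : `|t| * lform (e i) (emb z) <= 0.
  by apply: mulr_ge0_le0 => //; apply/ltW/neg.
by have := le 0 x; have := le 1 x1; have := le 2%:R x2; lra.
Qed.

(** * The Demazure process *)

Lemma reduced_demazure idx m : reduced (demazure L idx m).
Proof.
elim: m => [|m IH] /=; first by apply/eqP; rewrite -leqn0 ell_size.
case: ifP => // h; apply/eqP; rewrite eqn_leq ell_size size_rcons.
by rewrite -IH.
Qed.

Lemma demazure_cat idx m n : (m <= n)%N ->
  exists w, demazure L idx n = demazure L idx m ++ w.
Proof.
move=> /subnK <-; elim: (n - m)%N => [|k [w IH]]; first by exists [::]; rewrite cats0.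
rewrite addSn /= IH; case: ifP => _; last by exists w.
by exists (rcons w (idx (k + m)%N)); rewrite rcons_cat.
Qed.

(** If the process rested at [u], every letter would be proposed again and rejected, hence be a
    descent of [u]. *)
Lemma demazure_not_const idx : (forall N k, exists2 m, (N <= m)%N & idx m = k) ->
  ~ eventually_const L (demazure L idx).
Proof.
move=> hidx [N hN]; set u := demazure L idx N in hN.
apply: (@no_opposite_chamber (act L (rev u) z0)); first exact: inH_act.
move=> k; apply: descent_neg; have [m Nm <-] := hidx N k.
(* Equal group elements have equal length; as [u] is a prefix and both words are reduced, the words
   coincide. *)
have um : demazure L idx m = u.
  have [w E] := demazure_cat idx Nm; rewrite E -[RHS]cats0; congr (_ ++ _).
  have := ell_word (hN m Nm); rewrite reduced_demazure E size_cat /u reduced_demazure.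
  by move=> h; apply: size0nil; lia.
have := ell_word (hN m.+1 (leqW Nm)); rewrite /= um; case: ifP => [_ ->//|].
by rewrite ltnNge => /negbFE.
Qed.

Lemma demazure_boundary_limit idx : ~ eventually_const L (demazure L idx) ->
  exists zeta, conv_bdry (fun m => act L (demazure L idx m) z0) zeta.
Proof.
move=> nc; set u := demazure L idx in nc *.
have cat m n : (m <= n)%N -> exists2 w, u n = u m ++ w & reduced (u m ++ w).
  move=> /(demazure_cat idx)[w E]; exists w => //.
  by rewrite -[_ ++ w]E; exact: reduced_demazure.
have [d d1 sep] := reduced_separated.
apply: (boundary_limit (d := d)) => // [m|m n mn|m n mn|m].
- exact: inH_act.
- by have [w -> red] := cat _ _ mn; exact: hdist_prefix.
- by have [w -> red] := cat _ _ mn; rewrite hdist_act_cat; exact: hdist_suffix.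
(* From [n] on, every word strictly extends [u m], so separation applies. *)
have [n mn neq] : exists2 n, (m <= n)%N & u n <> u m.
  apply: contrapT => h; apply: nc; exists m => n mn.
  suff -> : u n = u m by [].
  by apply: contrapT => e'; apply: h; exists n.
exists n => n' nn'.
have [w E red] := cat _ _ (leq_trans mn nn'); rewrite E; apply: sep => //.
apply/eqP => w0; apply: neq.
have [w1 E1 _] := cat _ _ mn; have [w2 E2 _] := cat _ _ nn'.
move: E2; rewrite E E1 w0 -catA => /eqP; rewrite eqseq_cat // eqxx /=.
by case: w1 {E1}; rewrite ?cats0.
Qed.
End Coxeter.

(** * Almost surely every letter recurs *)

Section Recurrence.
Variables (R : realType) (d : measure_display) (T : measurableType d).
Variables (P : probability T R) (I : nat -> T -> 'I_3).
Hypothesis I_meas : forall m (k : 'I_3), measurable [set w | I m w = k].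
Hypothesis I_unif : forall ks : seq 'I_3,
  P [set w | forall m, (m < size ks)%N -> I m w = nth ord0 ks m]
    = ((1 / 3%:R) ^+ size ks)%:E.
Implicit Types (ks : seq 'I_3) (k : 'I_3).

Definition cylinder ks : set T :=
  [set w | forall m, (m < size ks)%N -> I m w = nth ord0 ks m].

Definition avoids k (D : set nat) : set T := [set w | forall m, D m -> I m w <> k].

Lemma measurable_cylinder ks : measurable (cylinder ks).
Proof.
rewrite (_ : cylinder ks =
  \bigcap_(m in [set m | (m < size ks)%N]) [set w | I m w = nth ord0 ks m]) //.
by apply: bigcap_measurableType.
Qed.

Lemma measurable_avoids k D : measurable (avoids k D).
Proof.
rewrite (_ : avoids k D = \bigcap_(m in D) ~` [set w | I m w = k]) //.
by apply: bigcap_measurableType => m _; exact: measurableC.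
Qed.

Lemma cylinder_split ks (B : set T) (b : 'I_3 -> R) : measurable B ->
  (forall j, (P (cylinder (rcons ks j) `&` B) <= (b j)%:E)%E) ->
  (P (cylinder ks `&` B) <= (b 0 + b 1 + b 2%:R)%:E)%E.
Proof.
move=> mB hb; pose A j := cylinder (rcons ks j) `&` B.
have mA j : measurable (A j) by apply: measurableI => //; exact: measurable_cylinder.
have sub : cylinder ks `&` B `<=` A 0 `|` A 1 `|` A 2%:R.
  move=> w [hw Bw]; have Aw : A (I (size ks) w) w.
    split=> // m; rewrite size_rcons ltnS nth_rcons leq_eqVlt => /orP[/eqP ->|mk].
      by rewrite ltnn eqxx.
    by rewrite mk hw.
  case: (I (size ks) w) Aw => -[|[|[|//]]] hk.
  - by rewrite (_ : Ordinal hk = 0); [left; left|apply: val_inj].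
  - by rewrite (_ : Ordinal hk = 1); [left; right|apply: val_inj].
  - by rewrite (_ : Ordinal hk = 2%:R); [right|apply: val_inj].
apply: (@le_trans _ _ (P (A 0 `|` A 1 `|` A 2%:R))).
  apply: le_measure => //; rewrite inE.
    by apply: measurableI => //; exact: measurable_cylinder.
  by apply: measurableU => //; exact: measurableU.
apply: le_trans (measureU2 P _ _) _ => //; first exact: measurableU.
rewrite EFinD leeD //; last exact: hb.
by apply: le_trans (measureU2 P _ _) _ => //; rewrite EFinD leeD //; exact: hb.
Qed.

(** Induction first on the gap [n], where all three next letters are allowed and the bound is
    preserved, then on [M], where only two are allowed. *)
Lemma cylinder_avoids_le ks k n M :
  (P (cylinder ks `&` avoids k [set m | (size ks + n <= m < size ks + n + M)%N])
    <= ((1 / 3%:R) ^+ size ks * (2 / 3) ^+ M)%:E)%E.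
Proof.
elim: n ks => [|n IH] ks; last first.
  have := @cylinder_split ks
    (avoids k [set m | (size ks + n.+1 <= m < size ks + n.+1 + M)%N])
    (fun=> (1 / 3%:R) ^+ (size ks).+1 * (2 / 3) ^+ M) (measurable_avoids _ _).
  move=> h; apply: le_trans (h _) _.
    by move=> j; have := IH (rcons ks j); rewrite size_rcons addSnnS.
  by rewrite lee_fin exprS; lra.
elim: M ks => [|M IH] ks.
  rewrite expr0 mulr1 -I_unif; apply: le_measure; rewrite ?inE //.
  - by apply: measurableI; [exact: measurable_cylinder|exact: measurable_avoids].
  - exact: measurable_cylinder.
(* The extension by [k] contributes zero and the other two contribute [c] each, which yields the
   factor [2 / 3]. *)
pose c := (1 / 3%:R) ^+ (size ks).+1 * (2 / 3) ^+ M : R.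
have := @cylinder_split ks
  (avoids k [set m | (size ks + 0 <= m < size ks + 0 + M.+1)%N])
  (fun j => if j == k then 0 else c) (measurable_avoids _ _).
move=> h; apply: le_trans (h _) _.
  move=> j; case: eqP => [->|_].
    rewrite (_ : _ `&` _ = set0) ?measure0 // -subset0 => w [hw aw].
    apply: (aw (size ks)); first by rewrite /= addn0 leqnn addnS ltnS leq_addr.
    by rewrite hw ?size_rcons // nth_rcons ltnn eqxx.
  have := IH (rcons ks j); rewrite size_rcons; apply: le_trans.
  apply: le_measure; rewrite ?inE.
  - by apply: measurableI; [exact: measurable_cylinder|exact: measurable_avoids].
  - by apply: measurableI; [exact: measurable_cylinder|exact: measurable_avoids].
  move=> w [hw aw]; split => // m /= hm; apply: aw => /=; move: hm.
  by rewrite !addn0 addnS addSn => /andP[/ltnW -> ->].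
rewrite lee_fin (_ : _ + _ = 2 * c).
  by rewrite /c !exprS; lra.
by case: k {h IH} => -[|[|[|//]]] hk /=; rewrite /eq_op /=; lra.
Qed.

Lemma avoids_negligible k n : P.-negligible (avoids k [set m | (n <= m)%N]).
Proof.
apply/negligibleP; first exact: measurable_avoids.
have le M : (P (avoids k [set m | (n <= m)%N]) <= ((2 / 3) ^+ M)%:E)%E.
  have := cylinder_avoids_le [::] k n M; rewrite expr0 mul1r; apply: le_trans.
  apply: le_measure; rewrite ?inE; first exact: measurable_avoids.
    by apply: measurableI; [exact: measurable_cylinder|exact: measurable_avoids].
  by move=> w aw; split=> // m /= /andP[hm _]; exact: aw.
apply/eqP; rewrite eq_le measure_ge0 andbT leNgt; apply/negP => pos.
have fin : P (avoids k [set m | (n <= m)%N]) \is a fin_num.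
  by apply: fin_num_measure; exact: measurable_avoids.
have r0 : 0 < fine (P (avoids k [set m | (n <= m)%N])).
  by rewrite -lte_fin fineK.
have q0 : 0 <= 2 / 3 :> R by lra.
have q1 : 2 / 3 < 1 :> R by lra.
have : (fun M => (2 / 3 : R) ^+ M) @ \oo --> 0 by apply: cvg_expr; rewrite ger0_norm.
move=> /cvgrPdist_lt/(_ _ r0)[N _ /(_ N (leqnn N))] /=.
rewrite sub0r normrN ger0_norm ?exprn_ge0 //.
by rewrite ltNge => /negP; apply; rewrite -lee_fin fineK.
Qed.

Lemma ae_infinitely_often :
  {ae P, forall w, forall n k, exists2 m, (n <= m)%N & I m w = k}.
Proof.
pose A k n := avoids k [set m | (n <= m)%N].
have : P.-negligible (\bigcup_n (A 0 n `|` A 1 n `|` A 2%:R n)).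
  apply: negligible_bigcup => n.
  by do ![apply: negligibleU]; exact: avoids_negligible.
apply: negligibleS => w /= /existsNP[n /existsNP[k h]]; exists n => //.
have Aw : A k n w by move=> m hm e; apply: h; exists m.
case: k Aw {h} => -[|[|[|//]]] hk.
- by rewrite (_ : Ordinal hk = 0); [left; left|apply: val_inj].
- by rewrite (_ : Ordinal hk = 1); [left; right|apply: val_inj].
- by rewrite (_ : Ordinal hk = 2%:R); [right|apply: val_inj].
Qed.
End Recurrence.

(** * From the given lines to unit normals oriented towards [z0] *)

Theorem mainTheorem2 (R : realType) (L : 'I_3 -> hline R) (z0 : pt R)
  (d : measure_display) (T : measurableType d) (P : probability T R)
  (I : nat -> T -> 'I_3) :
  (forall i, line_ok (L i)) ->
  inH z0 ->
  (forall i i' : 'I_3, i != i' ->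
     cond_disjoint (L i) (L i') z0 \/ cond_angle (L i) (L i') z0) ->
  (forall m (k : 'I_3), measurable [set w | I m w = k]) ->
  (forall ks : seq 'I_3,
     P [set w | forall m, (m < size ks)%N -> I m w = nth ord0 ks m]
       = ((1 / 3%:R) ^+ size ks)%:E) ->
  {ae P, forall w, ~ eventually_const L (demazure L (I ^~ w))} /\
  (forall w, ~ eventually_const L (demazure L (I ^~ w)) ->
     exists zeta : option R,
       conv_bdry (fun m => act L (demazure L (I ^~ w) m) z0) zeta).
Proof.
move=> okL hz0 cond I_meas I_unif.
pose eps i := Num.sg (lfun (L i) z0).
pose e i := scalev (eps i) (lnormal (L i)).
have nz i : lfun (L i) z0 != 0.
  (* Any second line will do: both conditions place [z0] off [L i]. *)
  have [j ij] : exists j : 'I_3, i != j by exists (i + 1); case: i => -[|[|[|]]].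
  have [c|c] := cond _ _ ij.
    by have [] := cond_disjoint_lform (okL i) (okL j) hz0 c.
  by have [] := cond_angle_lform (okL i) (okL j) hz0 c.
have eps2 i : eps i * eps i = 1 by rewrite -expr2 sqr_sg nz.
have e_norm i : lform (e i) (e i) = 1.
  by rewrite lformZl lformZr mulrA eps2 mul1r lnormal_norm.
have e_refl i z v : inH z -> lform v (emb (refl (L i) z))
    = lform v (emb z) - 2 * lform (e i) (emb z) * lform v (e i).
  move=> hz; rewrite emb_refl // lformZl lformZr.
  congr (_ - _); rewrite -[LHS]mul1r -(eps2 i); ring.
have e_pos i : 0 < lform (e i) (emb z0).
  have : 0 < `|lfun (L i) z0| by rewrite normr_gt0.
  rewrite normrEsg -/(eps i) lfunE // mulrCA lformZl pmulr_rgt0 //.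
  by rewrite mulr_gt0 // lscale_gt0.
have e_gram i j : i != j -> lform (e i) (e j) <= -1 \/
    exists2 m, (2 <= m)%N & lform (e i) (e j) = - cos (pi / m%:R).
  move=> ij; rewrite lformZl lformZr mulrA.
  have [c|c] := cond _ _ ij.
    by left; have [] := cond_disjoint_lform (okL i) (okL j) hz0 c.
  by right; have [] := cond_angle_lform (okL i) (okL j) hz0 c.
split; last by move=> w; exact: (demazure_boundary_limit (e := e)).
apply: filterS (ae_infinitely_often I_meas I_unif) => w h.
exact: (demazure_not_const (e := e) (z0 := z0)).
Qed.
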